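(* Consider a network of $N\ge 2$ reinforced stochastic processes with irreducible interaction matrix $W$ and sequence $(r_n)_{n\ge 0}$, $0\le r_n<1$, as defined in the context, and assume $P(T_0)<1$, where $T_0=\{\boldsymbol{Z}_0=\boldsymbol{0}\}\cup\{\boldsymbol{Z}_0=\boldsymbol{1}\}$. Assume that at least one of the following holds: (1) $\sum_n r_n=+\infty$ and $W$ is aperiodic; (2) $\sum_n r_n(1-r_n)=+\infty$. Let $Z_\infty$ be the common almost sure limit of the processes $(Z_{n,l})_n$, $l\in V$, and let $T_\infty=\{Z_\infty=0\}\cup\{Z_\infty=1\}$. Then: (i) if $\sum_n r_n^2<+\infty$, then $P(T_\infty)<1$; (ii) if $\sum_n r_n^2=+\infty$, then $P(T_\infty)=1$ and $P(Z_\infty=1)=\boldsymbol{v}^\top E[\boldsymbol{Z}_0]$, where $\boldsymbol{v}$ is the unique vector with all entries in $(0,+\infty)$ such that $\boldsymbol{v}^\top W^\top=\boldsymbol{v}^\top$ and $\boldsymbol{v}^\top\boldsymbol{1}=1$. In particular, when $\lim_n n^\gamma r_n=c>0$, case (i) is verified if $1/2<\gamma\le 1$ and case (ii) is verified if $0<\gamma\le 1/2$.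
   Context: Network of reinforced stochastic processes: $V=\{1,\dots,N\}$, $N\ge 2$; $W=[w_{l_1,l_2}]_{l_1,l_2\in V}$ is a deterministic matrix with entries $w_{l_1,l_2}\ge 0$ and $\sum_{l_1=1}^N w_{l_1,l_2}=1$ for each $l_2\in V$ (i.e. $W^\top\boldsymbol{1}=\boldsymbol{1}$). $\{Z_{0,l}:l\in V\}$ are random variables with values in $[0,1]$; for each $n\ge 1$, $\{X_{n,l}:l\in V\}$ are random variables with values in $\{0,1\}$. Put $\mathcal{F}_n=\sigma(Z_{0,l}:l\in V)\vee\sigma(X_{k,l}:1\le k\le n,\ l\in V)$. For each $n\ge 0$, the variables $\{X_{n+1,l}:l\in V\}$ are conditionally independent given $\mathcal{F}_n$ with $P(X_{n+1,l}=1\mid\mathcal{F}_n)=\sum_{l_1=1}^N w_{l_1,l}Z_{n,l_1}$ a.s., and $Z_{n+1,l}=(1-r_n)Z_{n,l}+r_nX_{n+1,l}$ for each $l\in V$, where $(r_n)_{n\ge 0}$ is a deterministic sequence with $0\le r_n<1$. Notation: $\boldsymbol{Z}_n=(Z_{n,1},\dots,Z_{n,N})^\top$; $\boldsymbol{0}$ and $\boldsymbol{1}$ are the vectors with all entries $0$, respectively $1$. Periodicity: the period of $l\in V$ is the greatest common divisor of the integers $n\ge 1$ with $(W^n)_{l,l}>0$; if $W$ is irreducible all periods coincide, and $W$ is aperiodic if this common period is $1$. Known fact (complete almost sure asymptotic synchronization): when $W$ is irreducible and (1) or (2) holds, all the processes $(Z_{n,l})_n$, $l\in V$, converge almost surely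 to one and the same random variable $Z_\infty$. *)

(* Defs.v *)
From HB Require Import structures.
From mathcomp Require Import all_boot all_order all_algebra.
From mathcomp Require Import all_classical all_reals all_analysis.

Set Implicit Arguments.
Unset Strict Implicit.
Unset Printing Implicit Defensive.

Import Order.TTheory GRing.Theory Num.Theory.
Import numFieldNormedType.Exports.

Local Open Scope classical_set_scope.
Local Open Scope ring_scope.

Section matrices.
Context (R : realType) (N : nat).
Implicit Types (W : 'M[R]_N) (v : 'cV[R]_N).

Definition interaction_matrix W : Prop :=
  (forall l1 l2, 0 <= W l1 l2) /\ (forall l2, \sum_l1 W l1 l2 = 1).

Definition irreducible_mx W : Prop :=
  forall l1 l2, exists2 n : nat, (0 < n)%N & 0 < (W ^+ n) l1 l2.

(* The gcd of a possibly infinite set of integers is characterized as its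
   greatest common divisor for divisibility. *)
Definition is_period W (l : 'I_N) (p : nat) : Prop :=
  (forall n : nat, (0 < n)%N -> 0 < (W ^+ n) l l -> (p %| n)%N) /\
  (forall q : nat,
     (forall n : nat, (0 < n)%N -> 0 < (W ^+ n) l l -> (q %| n)%N) ->
     (q %| p)%N).

(* Meant for irreducible W, whose indices all have the same period. *)
Definition aperiodic_mx W : Prop := forall l, is_period W l 1.

Definition positive_left_eigenvector W v : Prop :=
  [/\ forall l, 0 < v l 0,
      v^T *m W^T = v^T &
      v^T *m (const_mx 1 : 'cV[R]_N) = 1%:M].

End matrices.

Section conditioning.
Context (d : measure_display) (T : measurableType d) (R : realType).
Context (P : probability T R).
Implicit Types (G : set (set T)) (A : set T) (f : T -> R).

(* f is a version of P(A | G), for a sub-sigma-algebra G of measurable sets. *)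
Definition is_cond_prob G A f : Prop :=
  [/\ preimage_set_system setT f measurable `<=` G,
      P.-integrable setT (EFin \o f) &
      forall B, G B -> (\int[P]_(w in B) (f w)%:E = P (A `&` B))%E].

(* Taking B i = setT gives the product rule for subfamilies. *)
Definition cond_independent G (I : finType) (X : I -> {RV P >-> R}) : Prop :=
  forall (B : I -> set R) (f : I -> T -> R),
    (forall i, measurable (B i)) ->
    (forall i, is_cond_prob G (X i @^-1` B i) (f i)) ->
    is_cond_prob G (\bigcap_i (X i @^-1` B i)) (fun w => \prod_i f i w).

End conditioning.

Section network.
Context (d : measure_display) (T : measurableType d) (R : realType).
Context (P : probability T R) (N : nat).
Implicit Types (W : 'M[R]_N) (r : nat -> R).
Implicit Types Z X : nat -> 'I_N -> {RV P >-> R}.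

(* The variables X 0 l play no role. *)
Definition network_filtration Z X (n : nat) : set (set T) :=
  <<s (\bigcup_l preimage_set_system setT (Z 0%N l) measurable) `|`
      (\bigcup_(k in [set k | (1 <= k <= n)%N])
         \bigcup_l preimage_set_system setT (X k l) measurable) >>.

Record reinforced_network W r Z X : Prop := {
  rn_matrix : interaction_matrix W ;
  rn_rate : forall n, 0 <= r n < 1 ;
  rn_Z0 : forall l w, 0 <= Z 0%N l w <= 1 ;
  rn_X01 : forall n l w, X n.+1 l w = 0 \/ X n.+1 l w = 1 ;
  rn_indep : forall n,
    cond_independent (network_filtration Z X n) (fun l => X n.+1 l) ;
  rn_cond : forall n l,
    is_cond_prob P (network_filtration Z X n) (X n.+1 l @^-1` [set 1])
      (fun w => \sum_l1 W l1 l * Z n l1 w) ;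
  rn_rec : forall n l w,
    Z n.+1 l w = (1 - r n) * Z n l w + r n * X n.+1 l w
}.

Definition state Z (n : nat) (w : T) : 'cV[R]_N := \col_l Z n l w.

Definition trivial_start Z : set T :=
  [set w | state Z 0 w = 0] `|` [set w | state Z 0 w = const_mx 1].

Definition common_limit Z (Zoo : {RV P >-> R}) : Prop :=
  {ae P, forall w, forall l, (fun n => Z n l w) @ \oo --> Zoo w}.

Definition trivial_limit (Zoo : {RV P >-> R}) : set T :=
  [set w | Zoo w = 0] `|` [set w | Zoo w = 1].

End network.

(* Main.v *)
(* Let v be the Perron vector of W. Since W v = v, the weighted mean
   M_n = sum_l v_l Z_{n,l} is a martingale with limit Zoo, so E[Zoo] = E[M_0].
   Write p_{n,l} for the conditional probability that X_{n+1,l} = 1. The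
   quantity h_n = E[M_n (1 - M_n)] satisfies h_{n+1} = h_n - r_n^2 D_n with
   D_n = sum_l v_l^2 E[p_{n,l} (1 - p_{n,l})], because the X_{n+1,l} are
   conditionally independent. Moreover h_n -> h = E[Zoo (1 - Zoo)] and
   D_n -> (sum_l v_l^2) h. If sum r_n^2 diverges, convergence of h_n forces
   h = 0. If it converges, D_n <= h_n (Jensen) keeps h_n away from 0. Finally
   h = 0 means that Zoo is almost surely 0 or 1. *)

Require Import Defs.
From HB Require Import structures.
From mathcomp Require Import all_boot all_order all_algebra.
From mathcomp Require Import all_classical all_reals all_analysis.
From mathcomp Require Import measurable_realfun.
From mathcomp Require Import ring lra.

Set Implicit Arguments.
Unset Strict Implicit.
Unset Printing Implicit Defensive.

Import Order.TTheory GRing.Theory Num.Theory.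
Import numFieldNormedType.Exports.

Local Open Scope classical_set_scope.
Local Open Scope ring_scope.

(** * Perron vector *)

Section perron.
Context (R : realType) (N : nat).
Implicit Types (W : 'M[R]_N) (u v : 'cV[R]_N).

Lemma fixed_expmx W u n : W *m u = u -> W ^+ n *m u = u.
Proof.
move=> Wu; elim: n => [|n IH]; first by rewrite expr0 mul1mx.
by rewrite exprSr -mulmxE -mulmxA Wu.
Qed.

Lemma expmx_ge0 W n i j : (forall k l, 0 <= W k l) -> 0 <= (W ^+ n) i j.
Proof.
move=> W0; elim: n i j => [|n IH] i j; first by rewrite expr0 mxE ler0n.
by rewrite exprS -mulmxE mxE sumr_ge0 // => k _; rewrite mulr_ge0.
Qed.

(** Some entry u_j is positive, and irreducibility gives n with (W^n)_{i,j} > 0. Since W^n u = u,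
    the term of index j alone makes u_i positive. *)
Lemma fixed_gt0 W u : interaction_matrix W -> irreducible_mx W ->
  W *m u = u -> (forall i, 0 <= u i 0) -> u != 0 -> forall i, 0 < u i 0.
Proof.
move=> [W0 _] Wirr Wu u0 unz i.
have [j uj] : exists j, 0 < u j 0.
  apply: contra_notP (elimN eqP unz) => h; apply/matrixP => j k.
  rewrite ord1 mxE; apply/eqP; rewrite eq_le u0 andbT leNgt.
  by apply/negP => uj; apply: h; exists j.
have [n _ Wij] := Wirr i j.
rewrite -(fixed_expmx n Wu) mxE (bigD1 j) //= ltr_pwDl ?mulr_gt0 //.
by rewrite sumr_ge0 // => k _; rewrite mulr_ge0 // expmx_ge0.
Qed.

Lemma interaction_sum W u : interaction_matrix W ->
  \sum_i (W *m u) i 0 = \sum_i u i 0.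
Proof.
move=> [_ W1]; under eq_bigr do rewrite mxE.
rewrite exchange_big /=; apply: eq_bigr => j _.
by rewrite -mulr_suml W1 mul1r.
Qed.

(* The entrywise inequality |u| <= W |u| is an equality because both sides
   have the same sum of entries. *)
Lemma fixed_norm W u : interaction_matrix W -> W *m u = u ->
  W *m map_mx Num.norm u = map_mx Num.norm u.
Proof.
move=> WI Wu; set a := map_mx _ u.
have le i : a i 0 <= (W *m a) i 0.
  rewrite mxE -{1}Wu !mxE (le_trans (ler_norm_sum _ _ _)) // ler_sum // => j _.
  by rewrite normrM (ger0_norm (WI.1 _ _)) mxE.
have /eqP : \sum_i ((W *m a) i 0 - a i 0) = 0.
  by rewrite sumrB interaction_sum // subrr.
rewrite psumr_eq0 => [/allP h|i _]; last by rewrite subr_ge0.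
apply/matrixP => i k; rewrite ord1; apply/eqP; rewrite -subr_eq0.
by apply: h; rewrite mem_index_enum.
Qed.

(** The columns of W sum to 1, so the nonzero row of ones is killed by W - I. Hence W - I is
    singular and has a nonzero vector in its right kernel. *)
Lemma exists_fixed W : (0 < N)%N -> interaction_matrix W ->
  exists2 u : 'cV[R]_N, W *m u = u & u != 0.
Proof.
move=> N0 [_ W1].
(* [kermx] is a left kernel; transposing turns it into the right kernel of W - I. *)
have nf : kermx (W - 1%:M)^T != 0.
  rewrite kermx_eq0 row_free_unit unitmx_tr; apply/negP => Wu.
  have : (const_mx 1 : 'rV[R]_N) *m (W - 1%:M) = 0 :> 'rV[R]_N.
    rewrite mulmxBr mulmx1; apply/matrixP => i j; rewrite !mxE -[X in _ - X](W1 j).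
    by apply/eqP; rewrite subr_eq0; apply/eqP/eq_bigr => k _; rewrite mxE mul1r.
  move/(congr1 (mulmx^~ (invmx (W - 1%:M)))); rewrite /= mulmxK // mul0mx.
  by move/matrixP/(_ 0 (Ordinal N0)); rewrite !mxE => /eqP; rewrite oner_eq0.
have [w /sub_kermxP Hw wn0] := rowV0Pn nf.
exists w^T; last by rewrite trmx_eq0.
move/(congr1 trmx): Hw; rewrite trmx_mul trmxK mulmxBl mul1mx trmx0 => /eqP.
by rewrite subr_eq0 => /eqP.
Qed.

Lemma positive_left_eigenvectorP W v : positive_left_eigenvector W v <->
  [/\ forall l, 0 < v l 0, W *m v = v & \sum_l v l 0 = 1].
Proof.
rewrite /positive_left_eigenvector -trmx_mul.
have -> : v^T *m (const_mx 1 : 'cV[R]_N) = (\sum_l v l 0)%:M.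
  by apply/matrixP => i j; rewrite !ord1 !mxE eqxx;
    apply: eq_bigr => k _; rewrite !mxE mulr1.
split=> -[v0 vW v1]; split => //.
- exact: trmx_inj.
- by move/matrixP/(_ 0 0): v1; rewrite !mxE.
- by rewrite vW.
- by rewrite v1.
Qed.

(** Existence: normalise the entrywise absolute value of any nonzero fixed vector. Uniqueness: the
    difference w of two solutions is fixed with entries summing to 0, and [fixed_gt0] applied to its
    positive part leaves only w = 0. *)
Lemma perron_vector W : (0 < N)%N -> interaction_matrix W ->
  irreducible_mx W -> exists v : 'cV[R]_N, unique (positive_left_eigenvector W) v.
Proof.
move=> N0 WI Wirr; have [u Wu u0] := exists_fixed N0 WI.
set a := map_mx Num.norm u.
have Wa : W *m a = a := fixed_norm WI Wu.
have a0 : a != 0.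
  apply: contra_neq u0 => h; apply/matrixP => i j; apply/eqP.
  by move/matrixP/(_ i j)/eqP: h; rewrite !mxE normr_eq0.
have ap : forall i, 0 < a i 0 by apply: (fixed_gt0 WI) => // i; rewrite mxE.
have sp : 0 < \sum_i a i 0.
  rewrite (bigD1 (Ordinal N0)) //= ltr_pwDl // sumr_ge0 // => i _; exact: ltW.
exists ((\sum_i a i 0)^-1 *: a); split.
  apply/positive_left_eigenvectorP; split.
  - by move=> l; rewrite mxE mulr_gt0 ?invr_gt0.
  - by rewrite -scalemxAr Wa.
  - by under eq_bigr do rewrite mxE; rewrite -mulr_sumr mulVf // gt_eqF.
move=> v /positive_left_eigenvectorP[vp Wv v1].
set v' := _ *: a; pose w := v' - v.
have Ww : W *m w = w by rewrite mulmxBr Wv -scalemxAr Wa.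
have w0 : \sum_i w i 0 = 0.
  under eq_bigr do rewrite mxE [v' _ _]mxE [(- v) _ _]mxE.
  by rewrite sumrB v1 -mulr_sumr mulVf ?gt_eqF // subrr.
(* This is twice the positive part of w. If it were nonzero it would be positive everywhere, so w
   would be too, against its zero sum; hence w <= 0, and the zero sum gives w = 0. *)
pose b := map_mx Num.norm w + w.
have b0 i : 0 <= b i 0.
  rewrite [b _ _]mxE [X in X + _]mxE.
  by have := ler_norm (- w i 0); rewrite normrN; lra.
have Wb : W *m b = b by rewrite mulmxDr fixed_norm // Ww.
have bz : b = 0.
  apply/eqP; apply/negPn/negP => bn0.
  have bp := fixed_gt0 WI Wirr Wb b0 bn0.
  have wp i : 0 < w i 0.
    rewrite ltNge; apply/negP => wi; have := bp i.
    by rewrite [b i 0]mxE [X in X + _]mxE ler0_norm // addNr ltxx.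
  have : 0 < \sum_i w i 0.
    rewrite (bigD1 (Ordinal N0)) //= ltr_pwDl // sumr_ge0 // => i _; exact: ltW.
  by rewrite w0 ltxx.
have wN i : 0 <= - w i 0.
  by move/matrixP/(_ i 0)/eqP: bz; rewrite !mxE addr_eq0 => /eqP <-.
apply/eqP; rewrite -subr_eq0 -/w; apply/eqP/matrixP => i j; rewrite ord1 [RHS]mxE.
have /eqP : \sum_i - w i 0 = 0 by rewrite sumrN w0 oppr0.
rewrite psumr_eq0 => [/allP h|k _]; last exact: wN.
by apply/eqP; rewrite -oppr_eq0; apply: h; rewrite mem_index_enum.
Qed.

End perron.

(** * Nonnegative series *)

Section nonnegative_series.
Context (R : realType).
Implicit Types (a b t h : nat -> R).

Lemma nneseries_lty_bounded a C : (forall n, 0 <= a n) ->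
  (forall n, \sum_(0 <= k < n) a k <= C) ->
  (\sum_(0 <= k <oo) (a k)%:E < +oo)%E.
Proof.
move=> a0 aC; apply: (@le_lt_trans _ _ C%:E); last exact: ltry.
apply: lime_le; first by apply: is_cvg_nneseries => n _ _; rewrite lee_fin.
by apply: nearW => n; rewrite sumEFin lee_fin.
Qed.

Lemma nneseries_unbounded a C : (forall n, 0 <= a n) ->
  (\sum_(0 <= k <oo) (a k)%:E = +oo)%E ->
  exists n, C < \sum_(0 <= k < n) a k.
Proof.
move=> a0 aoo; apply: contrapT => h.
have : (\sum_(0 <= k <oo) (a k)%:E < +oo)%E.
  apply: (@nneseries_lty_bounded _ C) => // n; rewrite leNgt.
  by apply/negP => Cn; apply: h; exists n.
by rewrite aoo.
Qed.

Lemma nneseries_lty_le a : (forall n, 0 <= a n) ->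
  (\sum_(0 <= k <oo) (a k)%:E < +oo)%E ->
  forall n, series a n <= limn (series a).
Proof.
move=> a0 aoo; apply: nondecreasing_cvgn_le; last exact: nnseries_is_cvg.
by apply/nondecreasing_seqP => n; rewrite seriesSr lerDl.
Qed.

Lemma nneseries_lty_tail a e : (forall n, 0 <= a n) -> 0 < e ->
  (\sum_(0 <= k <oo) (a k)%:E < +oo)%E ->
  exists m, forall n, (m <= n)%N -> \sum_(m <= k < n) a k <= e.
Proof.
move=> a0 e0 aoo.
have /cvgrPdist_le/(_ e e0)[m _ hm] : series a @ \oo --> limn (series a).
  exact: nnseries_is_cvg.
exists m => n mn; rewrite -sub_series_geq // lerBlDr.
rewrite (le_trans (nneseries_lty_le a0 aoo n)) // -lerBlDr.
exact: le_trans (ler_norm _) (hm m (leqnn m)).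
Qed.

Lemma nneseries_lty_telescope b t m : (forall n, 0 <= b n) ->
  (forall n, 0 <= t n) ->
  (forall n, (m <= n)%N -> b n.+1 <= t n - t n.+1) ->
  (\sum_(0 <= k <oo) (b k)%:E < +oo)%E.
Proof.
move=> b0 t0 bt; pose C := series b m.+1 + t m.
(* The left side does not increase with n from m on, and equals C at n = m. *)
have key n : (m <= n)%N -> series b n.+1 + t n <= C.
  elim: n => [|n IH]; first by rewrite leqn0 => /eqP <-.
  rewrite leq_eqVlt => /predU1P[<- //|]; rewrite ltnS => mn.
  by rewrite seriesSr; have := IH mn; have := bt _ mn; lra.
apply: (@nneseries_lty_bounded _ C) => // n.
have nd : nondecreasing_seq (series b).
  by apply/nondecreasing_seqP => k; rewrite seriesSr lerDl.
apply: (@le_trans _ _ (series b (maxn m n).+1)).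
  by apply: nd; rewrite leqW // leq_maxr.
by have := key (maxn m n) (leq_maxl _ _); have := t0 (maxn m n); lra.
Qed.

(** Comparison test, by contraposition. The shift from n to n + 1 suits [harmonic], whose term of
    index n is 1/(n+1). *)
Lemma nneseries_dvg b h c m : (forall n, 0 <= b n) -> (forall n, 0 <= h n) ->
  0 < c -> (forall n, (m <= n)%N -> c * h n <= b n.+1) ->
  ~ cvgn (series h) -> (\sum_(0 <= k <oo) (b k)%:E = +oo)%E.
Proof.
move=> b0 h0 c0 hb; apply: contra_notP => /eqP; rewrite -ltey => boo.
apply: nnseries_is_cvg => //; set L := limn (series b).
apply: (@nneseries_lty_bounded _ (series h m + c^-1 * L)) => // n.
have nd a : (forall k, 0 <= a k) -> nondecreasing_seq (series a).
  by move=> a0; apply/nondecreasing_seqP => k; rewrite seriesSr lerDl.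
have key k : c * series h (m + k)%N + series b m.+1 <=
    c * series h m + series b (m + k).+1.
  elim: k => [|k IH]; first by rewrite addn0.
  rewrite addnS seriesSr (seriesSr b (m + k).+1); have := hb (m + k)%N (leq_addr _ _).
  by rewrite mulrDr; move: IH; lra.
apply: (@le_trans _ _ (series h (m + n)%N)).
  by apply: nd => //; rewrite leq_addl.
rewrite -(ler_pM2l c0) mulrDr mulVKf ?gt_eqF //.
have := nneseries_lty_le b0 boo (m + n).+1.
have : 0 <= series b m.+1 by apply: sumr_ge0.
have := key n; rewrite -/L; lra.
Qed.

End nonnegative_series.

(** * Rates of polynomial decay *)

Section power_rates.
Context (R : realType).

(** The inequality exp y >= 1 + y is used twice: at y = -1/(n+1) it gives ln (n+1) - ln n >=
    1/(n+1), and at y = a (ln (n+1) - ln n) it bounds the ratio of the two powers below by 1 +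
    a/(n+1). *)
Lemma powRN_telescope (a : R) n : 0 < a -> (0 < n)%N ->
  a * n.+1%:R `^ (- (1 + a)) <= n%:R `^ (- a) - n.+1%:R `^ (- a).
Proof.
move=> a0 n0; have np k : (0 < k)%N -> 0 < k%:R :> R by rewrite ltr0n.
have pE k x : (0 < k)%N -> k%:R `^ x = expR (x * ln k%:R) :> R.
  by move=> k0; rewrite /powR gt_eqF // np.
have lnS : ln n%:R + n.+1%:R^-1 <= ln n.+1%:R :> R.
  rewrite -lerBrDr -ler_expR expRD !lnK ?posrE ?np //.
  rewrite -ler_pdivrMl ?np //; apply: le_trans (expR_ge1Dx _).
  rewrite le_eqVlt; apply/orP; left; apply/eqP.
  by rewrite -natr1; field; rewrite natr1 pnatr_eq0.
have -> : n.+1%:R `^ (- (1 + a)) = n.+1%:R `^ (- a) * n.+1%:R^-1 :> R.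
  rewrite opprD addrC powRD; first by rewrite powR_inv1.
  by rewrite pnatr_eq0 implybT.
have : n.+1%:R `^ (- a) * (1 + a * n.+1%:R^-1) <= n%:R `^ (- a).
  rewrite !pE // -ler_pdivlMl ?expR_gt0 // -expRN -expRD.
  apply: le_trans (expR_ge1Dx _); rewrite lerD2l.
  by rewrite !mulNr opprK -mulrBr ler_pM2l // lerBrDl.
by rewrite mulrDr mulr1 mulrCA -lerBrDl.
Qed.

(** Eventually n^gamma r_n <= c + 1, so r_n^2 <= (c + 1)^2 n^(-(1 + a)) with a = 2 gamma - 1 > 0,
    and [powRN_telescope] makes the right side telescope. *)
Lemma sum_sqr_rate_lty (r : nat -> R) (gamma c : R) : (forall n, 0 <= r n) ->
  (fun n : nat => n%:R `^ gamma * r n) @ \oo --> c -> 1 / 2 < gamma ->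
  (\sum_(0 <= n <oo) (r n ^+ 2)%:E < +oo)%E.
Proof.
move=> r0 rc g2; pose a := 2 * gamma - 1; have a0 : 0 < a by rewrite /a; lra.
have /cvgrPdist_le/(_ 1 ltr01)[m _ hm] := rc.
(* The division by a cancels the factor a in [powRN_telescope]. *)
pose C := (c + 1) ^+ 2 / a; have C0 : 0 <= C by rewrite divr_ge0 ?sqr_ge0 ?ltW.
apply: (@nneseries_lty_telescope _ _ (fun n => C * n%:R `^ (- a)) m.+1).
- by move=> n; exact: sqr_ge0.
- by move=> n; rewrite mulr_ge0 ?powR_ge0.
move=> n mn; rewrite -mulrBr; have n0 : (0 < n)%N by exact: leq_ltn_trans mn.
apply: le_trans (ler_wpM2l C0 (powRN_telescope a0 n0)).
rewrite mulrA divfK ?gt_eqF //.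
have -> : - (1 + a) = - gamma * 2%:R by rewrite /a; lra.
rewrite powRrM powR_mulrn ?powR_ge0 // -exprMn ler_pXn2r ?nnegrE //.
  rewrite powRN ler_pdivlMr ?powR_gt0 ?ltr0n // mulrC.
  have := hm n.+1 (leqW (ltnW mn)); rewrite /= ler_norml; lra.
(* Squares may be compared because c + 1 dominates a nonnegative n^gamma r_n. *)
apply: mulr_ge0; last exact: powR_ge0.
have := hm n (ltnW mn); rewrite /= ler_norml.
by have := mulr_ge0 (powR_ge0 n%:R gamma) (r0 n); lra.
Qed.

(** Eventually n^gamma r_n >= c/2, and 2 gamma <= 1, so r_{n+1}^2 is at least (c/2)^2 / (n+1). *)
Lemma sum_sqr_rate_dvg (r : nat -> R) (gamma c : R) : (forall n, 0 <= r n) -> 0 < c ->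
  (fun n : nat => n%:R `^ gamma * r n) @ \oo --> c -> gamma <= 1 / 2 ->
  (\sum_(0 <= n <oo) (r n ^+ 2)%:E = +oo)%E.
Proof.
move=> r0 c0 rc g2; have c2 : 0 < c / 2 by rewrite divr_gt0.
have /cvgrPdist_le/(_ _ c2)[m _ hm] := rc.
apply: (@nneseries_dvg _ _ (@harmonic R) ((c / 2) ^+ 2) m).
- by move=> n; exact: sqr_ge0.
- exact: harmonic_ge0.
- by rewrite exprn_gt0.
- move=> n mn; rewrite /harmonic /=.
  have n1 : 1 <= n.+1%:R :> R by rewrite ler1n.
  apply: (@le_trans _ _ ((c / 2) ^+ 2 * n.+1%:R `^ (- (gamma * 2%:R)))).
    rewrite ler_pM2l ?exprn_gt0 // -powR_inv1 // ler_powR //; lra.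
  rewrite -mulNr powRrM powR_mulrn ?powR_ge0 // -exprMn ler_pXn2r ?nnegrE //.
    rewrite powRN ler_pdivrMr ?powR_gt0 ?ltr0n // mulrC.
    by have := hm n.+1 (leqW mn); rewrite /= ler_norml; lra.
  by rewrite mulr_ge0 ?powR_ge0 // ltW.
- exact: dvg_harmonic.
Qed.

End power_rates.

(** * Bounded random variables and conditional probabilities *)

Section bounded_random_variables.
Context (d : measure_display) (T : measurableType d) (R : realType).
Context (P : probability T R).
Implicit Types (f g : T -> R) (A B : set T) (G : set (set T)).

(** Closed under sums and products and integrable under a probability, this class settles the
    integrability conditions of the moment computations. *)
Definition bounded_measurable f : Prop :=
  measurable_fun setT f /\ exists C : R, forall w, `|f w| <= C.

Lemma bounded_measurable_integrable f : bounded_measurable f ->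
  P.-integrable setT (EFin \o f).
Proof.
move=> [mf [C fC]]; apply: measurable_bounded_integrable => //.
  exact: le_lt_trans (probability_le1 P measurableT) (ltry 1).
by exists C; split; rewrite ?num_real // => x Cx w _ /=; exact: le_trans (fC w) (ltW Cx).
Qed.

Lemma bounded_measurable_01 f : measurable_fun setT f ->
  (forall w, 0 <= f w <= 1) -> bounded_measurable f.
Proof.
move=> mf f01; split=> //; exists 1 => w; have /andP[f0 f1] := f01 w.
by rewrite ger0_norm.
Qed.

Lemma bounded_measurable_cst c : bounded_measurable (fun=> c).
Proof. by split; [exact: measurable_cst|exists `|c|]. Qed.

Lemma bounded_measurableD f g : bounded_measurable f -> bounded_measurable g ->
  bounded_measurable (fun w => f w + g w).
Proof.
move=> [mf [C fC]] [mg [D gD]]; split; first exact: measurable_funD.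
by exists (C + D) => w; rewrite (le_trans (ler_normD _ _)) // lerD.
Qed.

Lemma bounded_measurableM f g : bounded_measurable f -> bounded_measurable g ->
  bounded_measurable (fun w => f w * g w).
Proof.
move=> [mf [C fC]] [mg [D gD]]; split; first exact: measurable_funM.
by exists (C * D) => w; rewrite normrM ler_pM.
Qed.

Lemma bounded_measurableZ c f : bounded_measurable f ->
  bounded_measurable (fun w => c * f w).
Proof. exact/bounded_measurableM/bounded_measurable_cst. Qed.

Lemma bounded_measurableB f g : bounded_measurable f -> bounded_measurable g ->
  bounded_measurable (fun w => f w - g w).
Proof.
move=> bf bg; under eq_fun do rewrite -mulN1r.
exact/bounded_measurableD/bounded_measurableZ.
Qed.

Lemma bounded_measurable_sum (I : Type) (s : seq I) (F : I -> T -> R) :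
  (forall i, bounded_measurable (F i)) ->
  bounded_measurable (fun w => \sum_(i <- s) F i w).
Proof.
move=> bF; elim: s => [|i s IH].
  by under eq_fun do rewrite big_nil; exact: bounded_measurable_cst.
by under eq_fun do rewrite big_cons; exact: bounded_measurableD.
Qed.

Lemma bounded_measurable_indic A : measurable A -> bounded_measurable \1_A.
Proof.
move=> mA; apply: bounded_measurable_01; first exact: measurable_indic.
by move=> w; rewrite indicE; case: (_ \in _); rewrite ?lexx ?ler01.
Qed.

Lemma bounded_RintegralD f g : bounded_measurable f -> bounded_measurable g ->
  \int[P]_w (f w + g w) = \int[P]_w f w + \int[P]_w g w.
Proof. by move=> bf bg; rewrite RintegralD //; exact: bounded_measurable_integrable. Qed.

Lemma bounded_RintegralZ c f : bounded_measurable f ->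
  \int[P]_w (c * f w) = c * \int[P]_w f w.
Proof. by move=> bf; rewrite RintegralZl //; exact: bounded_measurable_integrable. Qed.

Lemma bounded_RintegralB f g : bounded_measurable f -> bounded_measurable g ->
  \int[P]_w (f w - g w) = \int[P]_w f w - \int[P]_w g w.
Proof. by move=> bf bg; rewrite RintegralB //; exact: bounded_measurable_integrable. Qed.

Lemma Rintegral_const (c : R) : \int[P]_(w in setT) c = c.
Proof.
rewrite Rintegral_cst // -[RHS]mulr1; congr (_ * _).
exact: (congr1 fine (probability_setT P)).
Qed.

Lemma bounded_Rintegral_sum (I : Type) (s : seq I) (F : I -> T -> R) :
  (forall i, bounded_measurable (F i)) ->
  \int[P]_w (\sum_(i <- s) F i w) = \sum_(i <- s) \int[P]_w F i w.
Proof.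
move=> bF; elim: s => [|i s IH].
  rewrite big_nil -[RHS]Rintegral_const.
  by apply: eq_Rintegral => w _; rewrite big_nil.
rewrite big_cons -IH -bounded_RintegralD //; last exact: bounded_measurable_sum.
by apply: eq_Rintegral => w _; rewrite big_cons.
Qed.

Lemma Rintegral_mul_sum (I : finType) (a b : I -> R) (F H : I -> T -> R) :
  (forall i, bounded_measurable (F i)) -> (forall i, bounded_measurable (H i)) ->
  \int[P]_w ((\sum_i a i * F i w) * (\sum_i b i * H i w)) =
  \sum_i \sum_j a i * b j * \int[P]_w (F i w * H j w).
Proof.
move=> bF bH; have bFH i j := bounded_measurableM (bF i) (bH j).
transitivity (\int[P]_w \sum_i \sum_j (a i * b j * (F i w * H j w))).
  apply: eq_Rintegral => w _; rewrite mulr_suml; apply: eq_bigr => i _.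
  by rewrite mulr_sumr; apply: eq_bigr => j _; rewrite mulrACA.
rewrite bounded_Rintegral_sum => [|i]; last first.
  by apply: bounded_measurable_sum => j; exact: bounded_measurableZ.
apply: eq_bigr => i _; rewrite bounded_Rintegral_sum => [|j].
  by apply: eq_bigr => j _; rewrite bounded_RintegralZ.
exact: bounded_measurableZ.
Qed.

Lemma le_bounded_Rintegral f g : bounded_measurable f -> bounded_measurable g ->
  (forall w, f w <= g w) -> \int[P]_w f w <= \int[P]_w g w.
Proof.
by move=> bf bg fg; apply: le_Rintegral => //; exact: bounded_measurable_integrable.
Qed.

Lemma Rintegral_indic A : measurable A -> \int[P]_w \1_A w = fine (P A).
Proof. by move=> mA; rewrite /Rintegral integral_indic // setIT. Qed.

Lemma EFin_Rintegral f : bounded_measurable f ->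
  (\int[P]_w f w)%:E = (\int[P]_w (f w)%:E)%E.
Proof.
move=> bf; rewrite /Rintegral fineK //.
exact/integrable_fin_num/bounded_measurable_integrable.
Qed.

Lemma cond_prob_indic G A B f : measurable A -> measurable B -> G B ->
  bounded_measurable f -> is_cond_prob P G A f ->
  \int[P]_w (\1_A w * \1_B w) = \int[P]_w (f w * \1_B w).
Proof.
move=> mA mB GB bf [_ _ /(_ B GB) fB].
transitivity (\int[P]_w \1_(A `&` B) w).
  by apply: eq_Rintegral => w _; rewrite indicI.
rewrite Rintegral_indic; last exact: measurableI.
rewrite -fB -[LHS]/(\int[P]_(w in B) f w) Rintegral_mkcond; apply: eq_Rintegral => w _.
by rewrite patchE indicE; case: (w \in B); rewrite ?mulr1 ?mulr0.
Qed.

(** The sum counts the integers of {1, ..., k} that are at most x, so it is the integer part of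
    x. *)
Lemma dist_count_le (x : R) k : 0 <= x <= k%:R ->
  `|x - \sum_(j < k) (j.+1%:R <= x)%R%:R| <= 1.
Proof.
move=> /andP[x0 xk]; pose S m : R := \sum_(j < m) (j.+1%:R <= x)%R%:R.
have SS m : S m.+1 = S m + (m.+1%:R <= x)%R%:R by rewrite /S big_ord_recr.
have Sm m : S m <= m%:R.
  elim: m => [|m IH]; first by rewrite /S big_ord0.
  by rewrite SS -natr1 lerD // lern1 leq_b1.
have Sx m : S m <= x.
  elim: m => [|m IH]; first by rewrite /S big_ord0.
  rewrite SS; case: (leP m.+1%:R x) => h; last by rewrite addr0.
  by rewrite (le_trans _ h) // -natr1 lerD.
(* Either some integer up to k exceeds x, and the count is within 1 of x, or all k integers are
   counted. This form needs no bound x <= k, so it goes through by induction on k. *)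
have [h|h] : x - 1 <= S k \/ k%:R <= S k.
  elim: k {xk} => [|m [IH|IH]]; first by right; rewrite /S big_ord0.
    by left; rewrite SS (le_trans IH) // lerDl ler0n.
  rewrite SS; case: (leP m.+1%:R x) => h; first by right; rewrite -natr1 lerD.
  by left; rewrite addr0; move: h; rewrite -natr1; lra.
all: rewrite -/(S k) ger0_norm ?subr_ge0 //; lra.
Qed.

(* g is approximated by sums of indicators of G-measurable sets: up to 1,
   k g counts the integers in {1, ..., k} below it. *)
Lemma cond_prob_mul G A f g : measurable A -> is_cond_prob P G A f ->
  (forall w, 0 <= f w <= 1) -> measurable_fun setT g ->
  (forall w, 0 <= g w <= 1) -> preimage_set_system setT g measurable `<=` G ->
  \int[P]_w (\1_A w * g w) = \int[P]_w (f w * g w).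
Proof.
move=> mA cf f01 mg g01 gG.
have bA := bounded_measurable_indic mA.
have bg := bounded_measurable_01 mg g01.
have bf : bounded_measurable f.
  apply: bounded_measurable_01 => //; apply/measurable_EFinP.
  by have [_ /integrableP[]] := cf.
have bAf := bounded_measurableB bA bf.
apply/eqP; rewrite -subr_eq0 -bounded_RintegralB; try exact: bounded_measurableM.
under eq_Rintegral do rewrite -mulrBl.
set D := \int[P]_w _.
(* D does not depend on k, so by the Archimedean property it must vanish. *)
suff Dk k : k%:R * `|D| <= 1.
  apply/negPn/negP => Dn0; have Dp : 0 < `|D| by rewrite normr_gt0.
  have := Dk (Num.truncn (`|D|^-1)).+1; apply/negP; rewrite -ltNge.
  by rewrite -ltr_pdivrMr // mul1r; exact: truncnS_gt.
pose B j := setT `&` g @^-1` [set y | j.+1%:R <= k%:R * y].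
have mY j : measurable [set y : R | j.+1%:R <= k%:R * y].
  have := @measurable_funM _ R R setT (cst k%:R) id (measurable_cst _) (@measurable_id _ R _).
  move=> /(_ measurableT [set` `[j.+1%:R, +oo[%R] (measurable_itv _)).
  by rewrite setTI; congr measurable; apply/seteqP; split=> y /=; rewrite in_itv /= andbT.
have mB j : measurable (B j) by exact: mg.
have GB j : G (B j) by apply: gG; exists [set y | j.+1%:R <= k%:R * y].
have bB j := bounded_measurable_indic (mB j).
(* The fractional part of k g. The indicators contribute nothing to k D by [cond_prob_indic], so
   only this remainder, at most 1, is left. *)
pose e w := k%:R * g w - \sum_(j < k) \1_(B j) w.
have be : bounded_measurable e.
  by apply: bounded_measurableB; [exact: bounded_measurableZ|exact: bounded_measurable_sum].
have e1 w : `|e w| <= 1.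
  rewrite /e (eq_bigr (fun j : 'I_k => (j.+1%:R <= k%:R * g w)%R%:R)).
    apply: dist_count_le; have /andP[g0 g1] := g01 w.
    by rewrite mulr_ge0 // ler_piMr.
  move=> j _; rewrite indicE; congr (nat_of_bool _)%:R.
  by apply/idP/idP; [rewrite inE => -[]|move=> h; rewrite inE].
have DE : k%:R * D = \int[P]_w ((\1_A w - f w) * e w).
  rewrite -bounded_RintegralZ; last exact: bounded_measurableM.
  apply/eqP; rewrite -subr_eq0 -bounded_RintegralB;
    [|exact/bounded_measurableZ/bounded_measurableM|exact: bounded_measurableM].
  have bAB j : bounded_measurable (fun w => (\1_A w - f w) * \1_(B j) w).
    exact: bounded_measurableM.
  rewrite (_ : \int[P]_w _ =
    \int[P]_w \sum_(j < k) ((\1_A w - f w) * \1_(B j) w)); last first.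
    by apply: eq_Rintegral => w _; rewrite /e -mulr_sumr; ring.
  rewrite bounded_Rintegral_sum // big1 // => j _.
  under eq_Rintegral do rewrite mulrBl.
  rewrite bounded_RintegralB; try exact: bounded_measurableM.
  by rewrite (cond_prob_indic (G := G) (f := f)) // subrr.
rewrite -[k%:R]ger0_norm // -normrM DE.
have bAfe := bounded_measurableM bAf be.
apply: (le_trans (le_normr_Rintegral _ _)) => //.
  exact: bounded_measurable_integrable.
rewrite -[leRHS]Rintegral_const.
have b1 := bounded_measurable_cst 1.
apply: le_bounded_Rintegral => //.
  have [m [C hC]] := bAfe; split; first exact: measurableT_comp.
  by exists C => w; rewrite normr_id.
move=> w; rewrite normrM mulr_ile1 //.
have /andP[f0 f1] := f01 w; rewrite indicE ler_norml.
by case: (_ \in _); rewrite ?mulr1n ?mulr0n; apply/andP; split; lra.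
Qed.

Lemma cond_prob_mean G A f : G setT -> is_cond_prob P G A f ->
  \int[P]_w f w = fine (P A).
Proof. by move=> GT [_ _ /(_ _ GT)]; rewrite setIT /Rintegral => ->. Qed.

Lemma generated_setT (S : set (set T)) : <<s S >> setT.
Proof. by have := sigma_algebraCD (@sigma_algebra0 T setT S); rewrite setD0. Qed.

(** Lets [cond_independent] be applied to a subfamily, with the full event at the other indices. *)
Lemma cond_prob_setT (S : set (set T)) : <<s S>> `<=` measurable ->
  is_cond_prob P <<s S>> setT (fun=> 1).
Proof.
move=> mS; split.
- move=> _ [B _ <-]; rewrite setTI preimage_cst; case: ifP => _.
    exact: generated_setT.
  exact: sigma_algebra0.
- exact: bounded_measurable_integrable (bounded_measurable_cst 1).
- by move=> B /mS mB; rewrite setTI integral_cst // mul1e.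
Qed.

End bounded_random_variables.

(** * Moments of the weighted mean *)

Section reinforced_moments.
Context (d : measure_display) (T : measurableType d) (R : realType).
Context (P : probability T R) (N : nat) (W : 'M[R]_N) (r : nat -> R).
Context (Z X : nat -> 'I_N -> {RV P >-> R}) (v : 'cV[R]_N).
Context (hnet : reinforced_network W r Z X).
Context (hv : positive_left_eigenvector W v).

(** This is p_{n,l}, the version of the conditional probability given by [rn_cond]. *)
Definition drive (n : nat) (l : 'I_N) (w : T) : R := \sum_l1 W l1 l * Z n l1 w.

Definition weighted_mean (n : nat) (w : T) : R := \sum_l v l 0 * Z n l w.

Lemma RV_measurable (Y : {RV P >-> R}) : measurable_fun setT Y.
Proof. exact: measurable_funPT. Qed.

Lemma network_X01 n l w : 0 <= X n.+1 l w <= 1.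
Proof. by have [->|->] := rn_X01 hnet n l w; rewrite ?lexx ler01. Qed.

Lemma network_Z01 n l w : 0 <= Z n l w <= 1.
Proof.
elim: n => [|n /andP[z0 z1]]; first exact: rn_Z0 hnet l w.
have /andP[x0 x1] := network_X01 n l w.
have /andP[r0 /ltW r1] := rn_rate hnet n.
rewrite (rn_rec hnet); apply/andP; split.
  by rewrite addr_ge0 // mulr_ge0 // subr_ge0.
have := ler_wpM2l r0 x1; have : (1 - r n) * Z n l w <= (1 - r n) * 1.
  by rewrite ler_wpM2l // subr_ge0.
lra.
Qed.

Lemma network_drive01 n l w : 0 <= drive n l w <= 1.
Proof.
have [W0 W1] := rn_matrix hnet.
have h l1 := andP (network_Z01 n l1 w).
apply/andP; split.
  by rewrite sumr_ge0 // => l1 _; rewrite mulr_ge0 //; have [] := h l1.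
rewrite -(W1 l) ler_sum // => l1 _; rewrite ler_piMr //; by have [] := h l1.
Qed.

Lemma bounded_Z n l : bounded_measurable (Z n l).
Proof. by apply: bounded_measurable_01; [exact: RV_measurable|exact: network_Z01]. Qed.

Lemma bounded_X n l : bounded_measurable (X n.+1 l).
Proof. by apply: bounded_measurable_01; [exact: RV_measurable|exact: network_X01]. Qed.

Lemma bounded_drive n l : bounded_measurable (drive n l).
Proof. by apply: bounded_measurable_sum => l1; exact/bounded_measurableZ/bounded_Z. Qed.

Lemma bounded_weighted_mean n : bounded_measurable (weighted_mean n).
Proof. by apply: bounded_measurable_sum => l1; exact/bounded_measurableZ/bounded_Z. Qed.

Lemma weights_gt0 l : 0 < v l 0. Proof. by have [] := hv. Qed.

Lemma weights_sum : \sum_l v l 0 = 1.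
Proof. by have /positive_left_eigenvectorP[] := hv. Qed.

Lemma weights_le1 l : v l 0 <= 1.
Proof.
rewrite -weights_sum (bigD1 l) //= lerDl sumr_ge0 // => k _.
exact/ltW/weights_gt0.
Qed.

(** Here W v = v enters: averaging with the weights v does not see the interaction, which is what
    makes M_n a martingale. *)
Lemma weighted_meanE n w : weighted_mean n w = \sum_l v l 0 * drive n l w.
Proof.
have /positive_left_eigenvectorP[_ Wv _] := hv.
rewrite /drive; under [RHS]eq_bigr do rewrite mulr_sumr.
rewrite exchange_big /=; apply: eq_bigr => l1 _.
rewrite -{1}Wv mxE mulr_suml; apply: eq_bigr => l _.
by rewrite mulrA [v l 0 * _]mulrC.
Qed.

Lemma weighted_mean01 n w : 0 <= weighted_mean n w <= 1.
Proof.
have h l := andP (network_Z01 n l w); have v0 l := ltW (weights_gt0 l).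
apply/andP; split.
  by rewrite sumr_ge0 // => l _; rewrite mulr_ge0 //; have [] := h l.
by rewrite -weights_sum ler_sum // => l _; rewrite ler_piMr //; have [] := h l.
Qed.

Lemma weighted_meanS n w : weighted_mean n.+1 w =
  (1 - r n) * weighted_mean n w + r n * \sum_l v l 0 * X n.+1 l w.
Proof.
rewrite /weighted_mean !mulr_sumr -big_split; apply: eq_bigr => l _ /=.
by rewrite (rn_rec hnet); ring.
Qed.

Lemma X_indic n l : X n.+1 l = \1_(X n.+1 l @^-1` [set 1]) :> (T -> R).
Proof.
apply/funext => w; rewrite indicE.
have [h|h] := rn_X01 hnet n l w.
  rewrite h memNset //= h => /esym/eqP; rewrite oner_eq0 //.
by rewrite h mem_set.
Qed.

Lemma measurable_RV_preimage (Y : {RV P >-> R}) (B : set R) :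
  measurable B -> measurable (Y @^-1` B).
Proof. by move=> mB; rewrite -[X in measurable X]setTI; exact: RV_measurable. Qed.

Lemma network_filtration_measurable n : network_filtration Z X n `<=` measurable.
Proof.
apply: smallest_sub; first exact: sigma_algebra_measurable.
by move=> A [|[k _]] [l _] [B mB <-]; exact: RV_measurable.
Qed.

Lemma network_filtration_setT n : network_filtration Z X n setT.
Proof. exact: generated_setT. Qed.

Lemma mean_X_drive n l l' :
  \int[P]_w (X n.+1 l w * drive n l' w) = \int[P]_w (drive n l w * drive n l' w).
Proof.
rewrite [X in Rintegral _ _ X](_ : _ =
  fun w => \1_(X n.+1 l @^-1` [set 1]) w * drive n l' w); last first.
  by apply/funext => w; rewrite -X_indic.
apply: (cond_prob_mul (G := network_filtration Z X n)) => //.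
- exact: rn_cond hnet n l.
- exact: network_drive01.
- by have [] := bounded_drive n l'.
- exact: network_drive01.
(* As a version of a conditional probability, [drive n l'] is measurable for the filtration at time
   n. *)
- by have [] := rn_cond hnet n l'.
Qed.

Lemma mean_X n l : \int[P]_w (X n.+1 l w) = \int[P]_w (drive n l w).
Proof.
rewrite X_indic Rintegral_indic; last exact: measurable_RV_preimage.
apply/esym/(cond_prob_mean (G := network_filtration Z X n)).
  exact: network_filtration_setT.
exact: rn_cond hnet n l.
Qed.

Lemma mean_XX n l l' : l != l' ->
  \int[P]_w (X n.+1 l w * X n.+1 l' w) = \int[P]_w (drive n l w * drive n l' w).
Proof.
move=> ll'.
(* Full events away from l and l' reduce the product over all indices to two factors. *)
pose B i : set R := if (i == l) || (i == l') then [set 1] else setT.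
pose f i := if (i == l) || (i == l') then drive n i else fun=> 1.
have := rn_indep hnet (n := n) (B := B) (f := f).
case=> [i|i|_ _ /(_ setT) h0].
- by rewrite /B; case: ifP.
- rewrite /B /f; case: ifP => _; first exact: rn_cond hnet n i.
  rewrite preimage_setT; apply: cond_prob_setT; exact: network_filtration_measurable.
have {h0} := h0 (@network_filtration_setT n).
have -> : \bigcap_i (X n.+1 i @^-1` B i) =
    X n.+1 l @^-1` [set 1] `&` X n.+1 l' @^-1` [set 1].
  apply/seteqP; split=> [w h|w [h h'] i _] /=.
    by split; [have := h l I|have := h l' I]; rewrite /B eqxx ?orbT.
  by rewrite /B; case: ifP => // /orP[/eqP->|/eqP->].
have -> : (fun w => (\prod_i f i w)%:E) = (fun w => (drive n l w * drive n l' w)%:E).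
  apply/funext => w; rewrite (bigD1 l) //= (bigD1 l') /=; last by rewrite eq_sym.
  rewrite big1 ?mulr1 => [|i /andP[il il']]; last first.
    by rewrite /f (negbTE il) (negbTE il').
  by rewrite /f !eqxx orbT.
rewrite setIT => h.
transitivity (\int[P]_w \1_(X n.+1 l @^-1` [set 1] `&` X n.+1 l' @^-1` [set 1]) w).
  by apply: eq_Rintegral => w _; rewrite indicI -!X_indic.
rewrite Rintegral_indic; last by apply: measurableI; exact: measurable_RV_preimage.
by rewrite -h.
Qed.

Lemma mean_weighted_mean n :
  \int[P]_w weighted_mean n w = \int[P]_w weighted_mean 0 w.
Proof.
elim: n => // n <-.
have bX : bounded_measurable (fun w => \sum_l v l 0 * X n.+1 l w).
  by apply: bounded_measurable_sum => l; exact/bounded_measurableZ/bounded_X.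
have bM := bounded_weighted_mean n.
have E : \int[P]_w (\sum_l v l 0 * X n.+1 l w) = \int[P]_w weighted_mean n w.
  under [RHS]eq_Rintegral do rewrite weighted_meanE.
  rewrite !bounded_Rintegral_sum => [|l|l]; try exact/bounded_measurableZ/bounded_drive.
    apply: eq_bigr => l _; rewrite !bounded_RintegralZ ?mean_X //.
      exact: bounded_drive.
    exact: bounded_X.
  exact/bounded_measurableZ/bounded_X.
under eq_Rintegral do rewrite weighted_meanS.
rewrite bounded_RintegralD ?bounded_RintegralZ //; try exact: bounded_measurableZ.
by rewrite E; ring.
Qed.

(* The mean of the conditional variance of sum_l v_l X_{n+1,l}. *)
Definition innovation (n : nat) : R :=
  \int[P]_w \sum_l v l 0 ^+ 2 * (drive n l w * (1 - drive n l w)).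

(** This is h_n, and [innovation] is D_n. *)
Definition diversity (n : nat) : R :=
  \int[P]_w (weighted_mean n w * (1 - weighted_mean n w)).

Lemma bounded_var f : bounded_measurable f ->
  bounded_measurable (fun w : T => f w * (1 - f w) : R).
Proof.
move=> bf; apply: bounded_measurableM => //.
by apply: bounded_measurableB => //; exact: bounded_measurable_cst.
Qed.

(** Both squares expand into double sums. Off the diagonal the terms agree by [mean_XX]. On it X^2 =
    X, and p = p^2 + p (1 - p) leaves the conditional variance. *)
Lemma mean_sqr_X n :
  \int[P]_w ((\sum_l v l 0 * X n.+1 l w) * (\sum_l v l 0 * X n.+1 l w)) =
  \int[P]_w (weighted_mean n w * weighted_mean n w) + innovation n.
Proof.
have bX := bounded_X n; have bd := bounded_drive n.
under [in RHS]eq_Rintegral do rewrite weighted_meanE.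
rewrite !Rintegral_mul_sum // /innovation bounded_Rintegral_sum; last first.
  by move=> l; by apply: bounded_measurableZ; exact: bounded_var.
rewrite -big_split; apply: eq_bigr => l _ /=.
rewrite (bigD1 l) //= [in RHS](bigD1 l) //= addrAC; congr (_ + _); last first.
  by apply: eq_bigr => l' ll'; rewrite mean_XX // eq_sym.
rewrite bounded_RintegralZ; last exact: bounded_var.
rewrite -expr2 -mulrDr; congr (_ * _).
transitivity (\int[P]_w X n.+1 l w).
  by apply: eq_Rintegral => w _; have [->|->] := rn_X01 hnet n l w; rewrite ?mulr0 ?mulr1.
rewrite mean_X -bounded_RintegralD; [|exact: bounded_measurableM|exact: bounded_var].
by apply: eq_Rintegral => w _; ring.
Qed.

Lemma mean_weighted_mean_X n :
  \int[P]_w (weighted_mean n w * (\sum_l v l 0 * X n.+1 l w)) =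
  \int[P]_w (weighted_mean n w * weighted_mean n w).
Proof.
have bX := bounded_X n; have bd := bounded_drive n.
under [in LHS]eq_Rintegral do rewrite weighted_meanE.
under [in RHS]eq_Rintegral do rewrite weighted_meanE.
rewrite !Rintegral_mul_sum //; apply: eq_bigr => l _; apply: eq_bigr => l' _.
under [in LHS]eq_Rintegral do rewrite mulrC.
by rewrite mean_X_drive; under eq_Rintegral do rewrite mulrC.
Qed.

(** E[M_n] is constant. With Y the v-average of the X_{n+1,l}, E[M Y] = E[M^2] and E[Y^2] = E[M^2] +
    D_n. The coefficients (1 - r)^2 + 2 r (1 - r) + r^2 of E[M^2] add up to 1, so only r^2 D_n is
    added to the second moment. *)
Lemma diversityS n : diversity n.+1 = diversity n - r n ^+ 2 * innovation n.
Proof.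
have bX := bounded_X n; have bM := bounded_weighted_mean.
have bY : bounded_measurable (fun w => \sum_l v l 0 * X n.+1 l w).
  by apply: bounded_measurable_sum => l; exact: bounded_measurableZ.
have dE k : diversity k = \int[P]_w weighted_mean k w -
    \int[P]_w (weighted_mean k w * weighted_mean k w).
  rewrite -bounded_RintegralB //; last exact: bounded_measurableM.
  by apply: eq_Rintegral => w _; ring.
rewrite !dE !(mean_weighted_mean _.+1) (mean_weighted_mean n).
pose M := weighted_mean n; pose Y w := \sum_l v l 0 * X n.+1 l w.
have -> : \int[P]_w (weighted_mean n.+1 w * weighted_mean n.+1 w) =
    \int[P]_w ((1 - r n) ^+ 2 * (M w * M w) +
      (2 * r n * (1 - r n) * (M w * Y w) + r n ^+ 2 * (Y w * Y w))).
  by apply: eq_Rintegral => w _; rewrite weighted_meanS -/M -/(Y w) -/(M w); ring.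
have bMM : bounded_measurable (fun w => M w * M w).
  exact: (bounded_measurableM (bM n) (bM n)).
have bMY : bounded_measurable (fun w => M w * Y w).
  exact: (bounded_measurableM (bM n) bY).
have bYY : bounded_measurable (fun w => Y w * Y w).
  exact: (bounded_measurableM bY bY).
have bZ (c : R) f : bounded_measurable f -> bounded_measurable (fun w : T => c * f w).
  exact: bounded_measurableZ.
rewrite !bounded_RintegralD ?bounded_RintegralZ //; try exact: bZ; last first.
  by apply: bounded_measurableD; exact: bZ.
by rewrite mean_weighted_mean_X mean_sqr_X /M; ring.
Qed.

(* Jensen's inequality for the concave function x |-> x (1 - x), with the
   weights v, after bounding v_l ^ 2 by v_l. *)
Lemma innovation_le n : innovation n <= diversity n.
Proof.
apply: le_bounded_Rintegral.
- apply: bounded_measurable_sum => l; apply: bounded_measurableZ.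
  exact: bounded_var (bounded_drive n l).
- exact: bounded_var (bounded_weighted_mean n).
move=> w; have := weighted_meanE n w; move: (weighted_mean n w) => m mE.
have v0 l := ltW (weights_gt0 l).
apply: (@le_trans _ _ (\sum_l v l 0 * (drive n l w * (1 - drive n l w)))).
  apply: ler_sum => l _; have /andP[d0 d1] := network_drive01 n l w.
  rewrite ler_wpM2r ?mulr_ge0 ?subr_ge0 // expr2 ler_piMr //; exact: weights_le1.
(* The gap in Jensen's inequality is the v-weighted variance of the drives around their mean m. *)
have : 0 <= \sum_l v l 0 * (drive n l w - m) ^+ 2.
  by apply: sumr_ge0 => l _; rewrite mulr_ge0 ?sqr_ge0.
have -> : \sum_l v l 0 * (drive n l w - m) ^+ 2 =
    (1 - 2 * m) * (\sum_l v l 0 * drive n l w)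
    - \sum_l v l 0 * (drive n l w * (1 - drive n l w)) + m ^+ 2 * \sum_l v l 0.
  rewrite !mulr_sumr -sumrB -big_split; apply: eq_bigr => l _ /=; ring.
by rewrite -mE weights_sum; lra.
Qed.

Lemma innovation_ge0 n : 0 <= innovation n.
Proof.
apply: Rintegral_ge0 => w _; apply: sumr_ge0 => l _.
have /andP[d0 d1] := network_drive01 n l w.
by rewrite mulr_ge0 ?sqr_ge0 // mulr_ge0 // subr_ge0.
Qed.

Lemma diversity_sum m n : (m <= n)%N ->
  diversity n = diversity m - \sum_(m <= k < n) r k ^+ 2 * innovation k.
Proof.
elim: n => [|n IH]; first by rewrite leqn0 => /eqP ->; rewrite big_geq // subr0.
rewrite leq_eqVlt => /predU1P[->|]; first by rewrite big_geq // subr0.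
by rewrite ltnS => mn; rewrite big_nat_recr //= diversityS IH // opprD addrA.
Qed.

Lemma diversity_ge0 n : 0 <= diversity n.
Proof. exact: le_trans (innovation_ge0 n) (innovation_le n). Qed.

Lemma diversity_nonincreasing m n : (m <= n)%N -> diversity n <= diversity m.
Proof.
move=> mn; rewrite (diversity_sum mn) gerBl sumr_ge0 // => k _.
by rewrite mulr_ge0 ?sqr_ge0 ?innovation_ge0.
Qed.

End reinforced_moments.

(** * Almost sure limits *)

Section almost_sure_limits.
Context (d : measure_display) (T : measurableType d) (R : realType).
Context (P : probability T R).
Implicit Types (f g : T -> R) (A : set T).

Lemma prob1_ae A : measurable A -> P A = 1%E <-> {ae P, forall w, A w}.
Proof.
move=> mA; have mCA := measurableC mA; split=> [PA|[B [mB PB AB]]].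
  exists (~` A); split => //; rewrite (probability_setC P mA) PA.
  by rewrite subee.
have PCA : P (~` A) = 0%E by apply: (subset_measure0 _ _ AB) => //.
have := probability_setC P mCA; rewrite setCK PCA => ->.
by rewrite sube0.
Qed.

Lemma measurable_zeros f : measurable_fun setT f ->
  measurable [set w | f w = 0].
Proof.
by move=> mf; rewrite -[X in measurable X]setTI; exact: (mf measurableT [set 0]).
Qed.

Lemma prob1_Rintegral0 f : P.-integrable setT (EFin \o f) ->
  {ae P, forall w, 0 <= f w} ->
  P [set w | f w = 0] = 1%E <-> \int[P]_w f w = 0.
Proof.
move=> fint f0; have mf : measurable_fun setT (EFin \o f).
  by have /integrableP[] := fint.
have mA : measurable [set w | f w = 0] by exact/measurable_zeros/measurable_EFinP.
rewrite (prob1_ae mA); split=> [h|h].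
  rewrite /Rintegral (@ae_eq_integral _ _ _ P setT (cst 0%E)) ?integral0 //.
  by apply: filterS h => w fw _ /=; rewrite fw.
have : (\int[P]_w `|(EFin \o f) w| = 0)%E.
  rewrite (@ae_eq_integral _ _ _ P setT (EFin \o f)) //.
  - by rewrite -(fineK (integrable_fin_num _ fint)) // -[fine _]/(\int[P]_w f w) h.
  - exact: measurableT_comp.
  - by apply: filterS f0 => w fw _ /=; rewrite ger0_norm.
move/(ae_eq_integral_abs P measurableT mf).
by apply: filterS => w /(_ I) /= [].
Qed.

(** Dominated convergence with the constant 1. Integrability and sign of g are part of the
    conclusion, since the limit inherits its bounds only almost everywhere. *)
Lemma unit_bounded_cvg (f : nat -> T -> R) g :
  (forall n, measurable_fun setT (f n)) -> (forall n w, 0 <= f n w <= 1) ->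
  measurable_fun setT g -> {ae P, forall w, f ^~ w @ \oo --> g w} ->
  [/\ P.-integrable setT (EFin \o g), {ae P, forall w, 0 <= g w} &
      (fun n => \int[P]_w f n w) @ \oo --> \int[P]_w g w].
Proof.
move=> mf f01 mg fg.
have f0 n w : 0 <= f n w by have /andP[] := f01 n w.
have [gint _ cv] : [/\ P.-integrable setT (EFin \o g),
    [sequence \int[P]_w (`|(f n w)%:E - (g w)%:E|)]_n @ \oo --> 0 &
    [sequence \int[P]_w (f n w)%:E]_n @ \oo --> \int[P]_w (g w)%:E]%E.
  apply: (@dominated_convergence _ _ _ P setT measurableT _ _ (cst 1%E)) => //.
  - by move=> n; exact/measurable_EFinP.
  - exact/measurable_EFinP.
  - by apply: filterS fg => w fw _; apply: cvg_EFin => //; exact: nearW.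
  - exact: bounded_measurable_integrable (bounded_measurable_cst _ 1).
  - by apply: aeW => w n _; rewrite /= lee_fin ger0_norm //; have /andP[] := f01 n w.
split => //.
  apply: filterS fg => w fw; rewrite -(cvg_lim _ fw) //.
  by apply: limr_ge; [apply: cvgP fw|exact: nearW].
have gfin : (\int[P]_w (g w)%:E)%E \is a fin_num by exact: integrable_fin_num gint.
by move: cv; rewrite -(fineK gfin) => /fine_cvg.
Qed.

End almost_sure_limits.

Lemma cvg_linear_combination (R : realType) (I : finType) (c : I -> R)
    (f : I -> nat -> R) (l : I -> R) : (forall i, f i @ \oo --> l i) ->
  (fun n => \sum_i c i * f i n) @ \oo --> \sum_i c i * l i.
Proof.
move=> fl; apply: cvg_big => [|i _]; first exact: add_continuous.
by apply: cvgM; [exact: cvg_cst|exact: fl].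
Qed.

(** * Limits of the moments and the two regimes *)

Section limits.
Context (d : measure_display) (T : measurableType d) (R : realType).
Context (P : probability T R) (N : nat) (W : 'M[R]_N) (r : nat -> R).
Context (Z X : nat -> 'I_N -> {RV P >-> R}) (v : 'cV[R]_N).
Context (Zoo : {RV P >-> R}).
Context (hnet : reinforced_network W r Z X).
Context (hv : positive_left_eigenvector W v).
Context (hZoo : common_limit Z Zoo).

Lemma cvg_weighted_mean :
  {ae P, forall w, weighted_mean Z v ^~ w @ \oo --> Zoo w}.
Proof.
apply: filterS hZoo => w Zw.
rewrite -[Zoo w]mul1r -(weights_sum hv) mulr_suml.
exact: cvg_linear_combination.
Qed.

Lemma cvg_drive l w : (forall k, (fun n => Z n k w) @ \oo --> Zoo w) ->
  (fun n => drive W Z n l w) @ \oo --> Zoo w.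
Proof.
move=> Zw; rewrite -[Zoo w]mul1r -((rn_matrix hnet).2 l) mulr_suml.
exact: cvg_linear_combination.
Qed.

Lemma mean_limit : P.-integrable setT (EFin \o Zoo) /\
  \int[P]_w Zoo w = \sum_l v l 0 * \int[P]_w Z 0%N l w.
Proof.
have [iZ _ cv] := unit_bounded_cvg
  (fun n => (bounded_weighted_mean v hnet n).1) (weighted_mean01 hnet hv)
  (RV_measurable Zoo) cvg_weighted_mean.
split=> //; apply: cvg_unique cv _ => //.
rewrite (_ : (fun n => _) = cst (\sum_l v l 0 * \int[P]_w Z 0%N l w)).
  exact: cvg_cst.
apply/funext => n; rewrite (mean_weighted_mean hnet hv) bounded_Rintegral_sum.
  by apply: eq_bigr => l _; rewrite bounded_RintegralZ //; exact: bounded_Z hnet 0 l.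
by move=> l; apply: bounded_measurableZ; exact: bounded_Z hnet 0 l.
Qed.

Definition limit_diversity : R := \int[P]_w (Zoo w * (1 - Zoo w)).

Lemma cvg_diversity :
  [/\ P.-integrable setT (EFin \o (fun w => Zoo w * (1 - Zoo w))),
      {ae P, forall w, 0 <= Zoo w * (1 - Zoo w)} &
      diversity Z v @ \oo --> limit_diversity].
Proof.
apply: unit_bounded_cvg.
- by move=> n; have [] := bounded_var (bounded_weighted_mean v hnet n).
- move=> n w; have /andP[m0 m1] := weighted_mean01 hnet hv n w.
  by rewrite mulr_ge0 ?subr_ge0 // mulr_ile1 ?subr_ge0 // gerBl.
- apply: measurable_funM; first exact: RV_measurable.
  by apply: measurable_funB; [exact: measurable_cst|exact: RV_measurable].
- apply: filterS cvg_weighted_mean => w Zw.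
  by apply: cvgM => //; apply: cvgB => //; exact: cvg_cst.
Qed.

(** The columns of W sum to 1, so every drive also converges to [Zoo]; the summands then share one
    limit up to the factor v_l^2. *)
Lemma cvg_innovation :
  innovation W Z v @ \oo --> (\sum_l v l 0 ^+ 2) * limit_diversity.
Proof.
have [iZ _ _] := cvg_diversity.
have -> : (\sum_l v l 0 ^+ 2) * limit_diversity =
    \int[P]_w \sum_l v l 0 ^+ 2 * (Zoo w * (1 - Zoo w)).
  rewrite /limit_diversity -RintegralZl //.
  by apply: eq_Rintegral => w _; rewrite mulr_suml.
have v0 l := ltW (weights_gt0 hv l).
pose g w := \sum_l v l 0 ^+ 2 * (Zoo w * (1 - Zoo w)).
suff [] : [/\ P.-integrable setT (EFin \o g), {ae P, forall w, 0 <= g w} &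
    innovation W Z v @ \oo --> \int[P]_w g w] by [].
apply: unit_bounded_cvg.
- move=> n; apply: measurable_sum => l.
  by have [] := bounded_measurableZ (v l 0 ^+ 2) (bounded_var (bounded_drive hnet n l)).
- move=> n w; have d01 l := andP (network_drive01 hnet n l w).
  have e0 l : 0 <= drive W Z n l w * (1 - drive W Z n l w).
    by have [? ?] := d01 l; rewrite mulr_ge0 // subr_ge0.
  apply/andP; split; first by apply: sumr_ge0 => l _; rewrite mulr_ge0 ?sqr_ge0.
  rewrite -[leRHS](weights_sum hv); apply: ler_sum => l _; have [? ?] := d01 l.
  apply: (@le_trans _ _ (v l 0 ^+ 2 * 1)).
    apply: ler_wpM2l; first exact: sqr_ge0.
    by apply: mulr_ile1; rewrite ?subr_ge0 // gerBl.
  by rewrite mulr1 expr2 ler_piMr // (weights_le1 hv).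
- apply: measurable_sum => l; apply: measurable_funM; first exact: measurable_cst.
  apply: measurable_funM; first exact: RV_measurable.
  by apply: measurable_funB; [exact: measurable_cst|exact: RV_measurable].
- apply: filterS hZoo => w /cvg_drive dw.
  apply: cvg_linear_combination => l.
  by apply: cvgM => //; apply: cvgB => //; exact: cvg_cst.
Qed.

Lemma trivial_limitE :
  trivial_limit Zoo = [set w | Zoo w * (1 - Zoo w) = 0].
Proof.
apply/seteqP; split=> w /=; first by case=> ->; rewrite ?mul0r // subrr mulr0.
move/eqP; rewrite mulf_eq0 subr_eq0 => /orP[/eqP|/eqP/esym]; by [left|right].
Qed.

Lemma measurable_trivial_limit : measurable (trivial_limit Zoo).
Proof.
rewrite trivial_limitE; apply: measurable_zeros; apply/measurable_EFinP.
by have [/integrableP[]] := cvg_diversity.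
Qed.

Lemma trivial_limitP : P (trivial_limit Zoo) = 1%E <-> limit_diversity = 0.
Proof.
by have [iZ Z0 _] := cvg_diversity; rewrite trivial_limitE; exact: prob1_Rintegral0.
Qed.

(** All weights are positive and all Z_{0,l} lie in [0,1], so M_0 = 0 forces every entry to be 0.
    The same applied to 1 - Z_{0,l} treats M_0 = 1. *)
Lemma trivial_startE :
  trivial_start Z = [set w | weighted_mean Z v 0 w * (1 - weighted_mean Z v 0 w) = 0].
Proof.
have vp l := weights_gt0 hv l.
have sum0 (a : 'I_N -> R) : (forall l, 0 <= a l) -> \sum_l v l 0 * a l = 0 ->
    forall l, a l = 0.
  move=> a0 /eqP; rewrite psumr_eq0 => [/allP h l|l _]; last by rewrite mulr_ge0 // ltW.
  have := h l (mem_index_enum l).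
  by rewrite /= mulf_eq0 gt_eqF //= => /eqP.
have Z01 l w := andP (rn_Z0 hnet l w).
have comp w : 1 - weighted_mean Z v 0 w = \sum_l v l 0 * (1 - Z 0%N l w).
  by rewrite -{1}(weights_sum hv) -sumrB; apply: eq_bigr => l _; rewrite mulrBr mulr1.
apply/seteqP; split=> w /=.
  case=> /colP h; have Zw l := h l; [rewrite (_ : weighted_mean Z v 0 w = 0) ?mul0r //|].
    by apply: big1 => l _; have := Zw l; rewrite !mxE => ->; rewrite mulr0.
  rewrite comp big1 ?mulr0 // => l _; have := Zw l.
  by rewrite !mxE => ->; rewrite subrr mulr0.
move/eqP; rewrite mulf_eq0 => /orP[/eqP m0|/eqP m1]; [left|right]; apply/colP => l.
  by rewrite !mxE; apply: (sum0 (fun l => Z 0%N l w)) => // k; have [] := Z01 k w.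
rewrite !mxE; apply/eqP; rewrite eq_sym -subr_eq0; apply/eqP.
apply: (sum0 (fun l => 1 - Z 0%N l w)); last by rewrite -comp.
by move=> k; rewrite subr_ge0; have [] := Z01 k w.
Qed.

Lemma diversity0_gt0 : (P (trivial_start Z) < 1)%E -> 0 < diversity Z v 0.
Proof.
rewrite trivial_startE lt_neqAle => /andP[/eqP h _].
rewrite lt_neqAle (diversity_ge0 hnet hv) andbT; apply/eqP => d0; apply: h.
have bM := bounded_var (bounded_weighted_mean v hnet 0).
apply/(prob1_Rintegral0 (bounded_measurable_integrable P bM)); last exact/esym.
apply: aeW => w; have /andP[m0 m1] := weighted_mean01 hnet hv 0 w.
by rewrite mulr_ge0 // subr_ge0.
Qed.

Lemma nontrivial_limit : (P (trivial_start Z) < 1)%E ->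
  (\sum_(0 <= n <oo) (r n ^+ 2)%:E < +oo)%E -> (P (trivial_limit Zoo) < 1)%E.
Proof.
move=> /diversity0_gt0 h0 rfin; have [_ _ cvd] := cvg_diversity.
rewrite lt_neqAle probability_le1 ?andbT; last exact: measurable_trivial_limit.
apply/eqP => /trivial_limitP L0; rewrite L0 in cvd.
(* D_n <= h_n gives h_{n+1} >= (1 - r_n^2) h_n, and r_n < 1 keeps this positive. *)
have dp n : 0 < diversity Z v n.
  elim: n => // n IH; rewrite (diversityS hnet hv).
  have := ler_wpM2l (sqr_ge0 (r n)) (innovation_le hnet hv n).
  have /andP[r0 r1] := rn_rate hnet n.
  have : r n ^+ 2 < 1 by rewrite expr_lt1.
  by rewrite -subr_gt0 => /(mulr_gt0 IH); lra.
have [|m hm] := nneseries_lty_tail (e := 2^-1) (fun n => sqr_ge0 (r n)) _ rfin.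
  by rewrite invr_gt0.
(* After time m, each D_k is at most h_k <= h_m, and the r_k^2 sum to at most 1/2, so at most half
   of h_m is ever lost. *)
have lb n : (m <= n)%N -> diversity Z v m / 2 <= diversity Z v n.
  move=> mn; rewrite (diversity_sum hnet hv mn).
  have : \sum_(m <= k < n) r k ^+ 2 * innovation W Z v k <=
      diversity Z v m * \sum_(m <= k < n) r k ^+ 2.
    rewrite mulr_sumr [leLHS]big_nat_cond [leRHS]big_nat_cond; apply: ler_sum => k.
    rewrite andbT => /andP[mk _]; rewrite mulrC ler_wpM2r ?sqr_ge0 //.
    exact: le_trans (innovation_le hnet hv k) (diversity_nonincreasing hnet hv mk).
  have := ler_wpM2l (ltW (dp m)) (hm n mn); lra.
have : diversity Z v m / 2 <= 0.
  rewrite -(cvg_lim _ cvd) //; apply: limr_ge; first exact: cvgP cvd.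
  by exists m.
by have := dp m; lra.
Qed.

Lemma almost_surely_trivial_limit : (0 < N)%N ->
  (\sum_(0 <= n <oo) (r n ^+ 2)%:E = +oo)%E -> P (trivial_limit Zoo) = 1%E.
Proof.
move=> N0 rinf; apply/trivial_limitP; have [_ _ cvd] := cvg_diversity.
have L0 : 0 <= limit_diversity.
  rewrite -(cvg_lim _ cvd) //; apply: limr_ge; first exact: cvgP cvd.
  by apply: nearW => n; exact: diversity_ge0 hnet hv n.
apply/eqP; apply: contraT => Ln0.
have s0 : 0 < \sum_l v l 0 ^+ 2.
  rewrite (bigD1 (Ordinal N0)) //= ltr_pwDl ?exprn_gt0 ?(weights_gt0 hv) //.
  by apply: sumr_ge0 => l _; exact: sqr_ge0.
(* Half the limit of D_n, hence a lower bound for D_n from some m on. *)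
pose e := (\sum_l v l 0 ^+ 2) * limit_diversity / 2.
have e0 : 0 < e by rewrite divr_gt0 // mulr_gt0 // lt_neqAle eq_sym Ln0.
have [m _ hm] : \forall n \near \oo, e <= innovation W Z v n.
  by apply: (cvgr_ge _ cvg_innovation); rewrite -/e; move: e0; rewrite /e; lra.
(* Beyond the first m terms, the r_k^2 then sum to more than h_m / e, so the loss exceeds h_m and
   h_n would be negative. *)
have [n hn] := nneseries_unbounded (\sum_(0 <= k < m) r k ^+ 2 + diversity Z v m / e)
  (fun n => sqr_ge0 (r n)) rinf.
(* The case n < m is impossible: a shorter partial sum cannot exceed a longer one. *)
have [mn|nm] := leqP m n; last first.
  have : \sum_(0 <= k < n) r k ^+ 2 <= \sum_(0 <= k < m) r k ^+ 2.
    rewrite (big_cat_nat (leq0n n) (ltnW nm)) /= lerDl sumr_ge0 // => k _; exact: sqr_ge0.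
  have : 0 <= diversity Z v m / e by rewrite divr_ge0 ?(ltW e0) // (diversity_ge0 hnet hv).
  by move: hn; lra.
move: hn; rewrite (big_cat_nat (leq0n m) mn) /= ltrD2l ltr_pdivrMr // => hn.
have := diversity_ge0 hnet hv n; rewrite (diversity_sum hnet hv mn).
have : (\sum_(m <= k < n) r k ^+ 2) * e <= \sum_(m <= k < n) r k ^+ 2 * innovation W Z v k.
  rewrite mulr_suml [leLHS]big_nat_cond [leRHS]big_nat_cond; apply: ler_sum => k.
  rewrite andbT => /andP[mk _]; rewrite ler_wpM2l ?sqr_ge0 //; exact: hm.
by move: hn; lra.
Qed.

(** Almost surely [Zoo] is the indicator of the event that it equals 1, so the probability of this
    event is E[Zoo], which [mean_limit] computes from time 0. *)
Lemma prob_limit1 : P (trivial_limit Zoo) = 1%E ->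
  P [set w | Zoo w = 1] = (\sum_l (v l 0)%:E * 'E_P[Z 0%N l])%E.
Proof.
move=> PT; have [iZ mZ] := mean_limit.
have -> : (\sum_l (v l 0)%:E * 'E_P[Z 0%N l])%E = (\int[P]_w Zoo w)%:E.
  rewrite mZ -sumEFin; apply: eq_bigr => l _; rewrite EFinM unlock EFin_Rintegral //.
  exact: bounded_Z hnet 0 l.
have m1 : measurable [set w | Zoo w = 1].
  exact: (measurable_RV_preimage Zoo (measurable_set1 1)).
rewrite /Rintegral fineK ?integrable_fin_num // -[[set w | _]]setIT -integral_indic //.
apply: ae_eq_integral => //.
- by apply/measurable_EFinP; exact: measurable_indic.
- by case/integrableP: iZ.
move/(prob1_ae P measurable_trivial_limit): PT; apply: filterS => w Tw _ /=.
congr EFin; rewrite indicE; case: Tw => h.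
  by rewrite memNset ?h //= => /esym/eqP; rewrite h oner_eq0.
by rewrite mem_set.
Qed.

End limits.

(** * The dichotomy and its polynomial cases *)

Theorem theorem3p3 (d : measure_display) (T : measurableType d) (R : realType)
    (P : probability T R) (N : nat) (W : 'M[R]_N) (r : nat -> R)
    (Z X : nat -> 'I_N -> {RV P >-> R}) (Zoo : {RV P >-> R})
    (hN : (2 <= N)%N)
    (hnet : reinforced_network W r Z X)
    (hW : irreducible_mx W)
    (hT0 : (P (trivial_start Z) < 1)%E)
    (hsync : ((\sum_(0 <= n <oo) (r n)%:E = +oo)%E /\ aperiodic_mx W) \/
             (\sum_(0 <= n <oo) (r n * (1 - r n))%:E = +oo)%E)
    (hZoo : common_limit Z Zoo) :
  [/\ (\sum_(0 <= n <oo) (r n ^+ 2)%:E < +oo)%E ->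
        (P (trivial_limit Zoo) < 1)%E,
      (\sum_(0 <= n <oo) (r n ^+ 2)%:E = +oo)%E ->
        P (trivial_limit Zoo) = 1%E /\
        (exists v : 'cV[R]_N,
          unique (positive_left_eigenvector W) v /\
          P [set w | Zoo w = 1] = (\sum_l (v l 0)%:E * 'E_P[Z 0%N l])%E) &
      forall gamma c : R, 0 < c ->
        (fun n : nat => n%:R `^ gamma * r n) @ \oo --> c ->
        (1 / 2 < gamma <= 1 ->
           (\sum_(0 <= n <oo) (r n ^+ 2)%:E < +oo)%E /\
           (P (trivial_limit Zoo) < 1)%E) /\
        (0 < gamma <= 1 / 2 ->
           [/\ (\sum_(0 <= n <oo) (r n ^+ 2)%:E = +oo)%E,
               P (trivial_limit Zoo) = 1%E &
               exists v : 'cV[R]_N,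
                 unique (positive_left_eigenvector W) v /\
                 P [set w | Zoo w = 1] =
                   (\sum_l (v l 0)%:E * 'E_P[Z 0%N l])%E])].
Proof.
have N0 : (0 < N)%N by exact: leq_trans hN.
have [v uv] := perron_vector N0 (rn_matrix hnet) hW; have hv := uv.1.
have r0 n : 0 <= r n by have /andP[] := rn_rate hnet n.
have case1 := nontrivial_limit hnet hv hZoo hT0.
have case2 : (\sum_(0 <= n <oo) (r n ^+ 2)%:E = +oo)%E ->
    P (trivial_limit Zoo) = 1%E /\
    (exists v : 'cV[R]_N, unique (positive_left_eigenvector W) v /\
      P [set w | Zoo w = 1] = (\sum_l (v l 0)%:E * 'E_P[Z 0%N l])%E).
  move=> rinf; have PT := almost_surely_trivial_limit hnet hv hZoo N0 rinf.
  by split=> //; exists v; split=> //; exact: prob_limit1 hnet hv hZoo PT.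
split=> // gamma c c0 rc; split=> /andP[g1 g2].
  by have rfin := sum_sqr_rate_lty r0 rc g1; split=> //; exact: case1.
have rinf := sum_sqr_rate_dvg r0 c0 rc g2.
by have [PT hPT] := case2 rinf.
Qed.
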